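(* Let $k$ be a field and let $A(B)^C$ be a coalgebra-Galois extension over $k$ with both $A$ and $B$ finite dimensional. Suppose that $A$ is free as a right $B$-module. Let $(A,C)_\psi$ be the canonical entwining structure, with $\psi(c\otimes a)=a_\alpha\otimes c^\alpha$ (summation understood). Then $B\hookrightarrow A$ is a strongly separable extension if and only if there exist a normalised integral $\mathfrak z=\sum_ia_i\otimes c_i$ in $(A,C)_\psi$, a $k$-linear map $\phi:C\to A$ satisfying (i) $\psi(c_{(1)}\otimes\phi(c_{(2)}))=\phi(c)\rho^A(1_A)$ for all $c\in C$, (ii) $\sum_ja^j\phi(d_j)=1_A$, where $\sum_ja^j\otimes d_j=\rho^A(1_A)$, (iii) $b_\alpha\phi(c^\alpha)=\phi(c)b$ for all $b\in B$, $c\in C$, and a non-zero $\tau\in k$ such that $$\sum_ia_i\phi(c_i)=\tau$$ (where $\tau$ means $\tau1_A$).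
   Context: Algebras are associative unital $k$-algebras, coalgebras coassociative counital $k$-coalgebras, $\otimes=\otimes_k$; $\Delta_C(c)=c_{(1)}\otimes c_{(2)}$ and $\varepsilon_C$ are the coproduct and counit of $C$. Coalgebra-Galois extension. Let $C$ be a coalgebra, $A$ an algebra and a right $C$-comodule with coaction $\rho^A:A\to A\otimes C$, and let $B=\{b\in A\mid\rho^A(ba)=b\rho^A(a)\text{ for all }a\in A\}$, a subalgebra of $A$ ($A$ acts on $A\otimes C$ by left multiplication on the first factor). $B\hookrightarrow A$ is a coalgebra-Galois extension, denoted $A(B)^C$, if the map $\mathrm{can}:A\otimes_BA\to A\otimes C$, $a\otimes a'\mapsto a\rho^A(a')$, is bijective. The associated canonical entwining structure is $(A,C)_\psi$ with $\psi:C\otimes A\to A\otimes C$, $\psi(c\otimes a)=\mathrm{can}(\mathrm{can}^{-1}(1_A\otimes c)a)$. An integral in $(A,C)_\psi$ is an element $\mathfrak z=\sum_ia_i\otimes c_i\in A\otimes C$ such that $\sum_iaa_i\otimes c_i=\sum_ia_i\psi(c_i\otimes a)$ for all $a\in A$. It is normalised if $\sum_ia_i\varepsilon_C(c_i)=1$. Extensions of algebras $B\hookrightarrow A$. A separability idempotent is $u\in A\otimes_BA$ with $au=ua$ for all $a\in A$ and $\mu_{A,B}(u)=1_A$, where $\mu_{A,B}:A\otimes_BA\to A$ is induced by the product; the extension is separable if one exists. A conditional expectation is a unital $(B,B)$-bimodule map $E:A\to B$; the extension is split if one exists. The extension is strongly separable if it is separable and split and there exist a separability idempotent $u=\sum_iu_i\otimes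 u^i$, a conditional expectation $E:A\to B$ and a unit $\tau\in k$ such that for all $a\in A$: $\sum_iE(au_i)u^i=a\tau$ and $\sum_iu_iE(u^ia)=a\tau$. *)

(* Defs.v *)
From HB Require Import structures.
From mathcomp Require Import all_boot all_algebra.
From mathcomp Require Import generic_quotient ring_quotient sesquilinear.
From mathcomp Require Import finmap monalg.
From mathcomp Require Import boolp classical_sets.

Set Implicit Arguments.
Unset Strict Implicit.
Unset Printing Implicit Defensive.

Import GRing.Theory.
Local Open Scope ring_scope.
Local Open Scope quotient_scope.

Section Span.
Variables (k : fieldType) (V : lmodType k) (G : set V).

Definition gspan : {pred V} := fun v =>
  `[< exists2 s : seq (k * V), (forall p, p \in s -> G p.2)
                             & v = \sum_(p <- s) p.1 *: p.2 >].

Lemma spanP v : reflect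
  (exists2 s : seq (k * V), (forall p, p \in s -> G p.2)
                          & v = \sum_(p <- s) p.1 *: p.2)
  (v \in gspan).
Proof. exact: asboolP. Qed.

Lemma span_gen v : G v -> v \in gspan.
Proof.
move=> Gv; apply/spanP; exists [:: (1, v)]; last by rewrite big_seq1 scale1r.
by move=> p; rewrite inE => /eqP->.
Qed.

Lemma span_submod : submod_closed gspan.
Proof.
split; first by apply/spanP; exists [::]; rewrite ?big_nil.
move=> a _ _ /spanP[s Gs ->] /spanP[t Gt ->]; apply/spanP.
exists ([seq (a * p.1, p.2) | p <- s] ++ t) => [p|].
  by rewrite mem_cat => /orP[/mapP[q /Gs Gq ->]|/Gt].
rewrite big_cat big_map scaler_sumr /=; congr (_ + _).
by apply: eq_bigr => p _; rewrite scalerA.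
Qed.

HB.instance Definition _ := GRing.isSubmodClosed.Build k V gspan span_submod.

Definition quo := Quotient.quot gspan.
HB.instance Definition _ := ZmodQuotient.on quo.

Definition quo_scale (a : k) (x : quo) : quo := \pi_quo (a *: repr x).

Lemma quo_eqP (u v : V) : reflect (\pi_quo u = \pi_quo v) (u - v \in gspan).
Proof. by rewrite Quotient.idealrBE; apply: eqP. Qed.

Lemma pi_quo_scale a (v : V) : \pi_quo (a *: v) = quo_scale a (\pi_quo v).
Proof.
apply/quo_eqP; rewrite -scalerBr rpredZ //; apply/quo_eqP.
by rewrite reprK.
Qed.

Lemma quo_scaleA a b (x : quo) :
  quo_scale a (quo_scale b x) = quo_scale (a * b) x.
Proof. by rewrite -[x]reprK -(pi_quo_scale b) -!pi_quo_scale scalerA. Qed.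

Lemma quo_scale1 : left_id 1 quo_scale.
Proof. by move=> x; rewrite -[x]reprK -pi_quo_scale scale1r. Qed.

Lemma quo_scaleDr : right_distributive quo_scale +%R.
Proof.
move=> a x y; rewrite -[x]reprK -[y]reprK.
by rewrite -!pi_quo_scale -raddfD -pi_quo_scale scalerDr raddfD.
Qed.

Lemma quo_scaleDl (x : quo) : {morph quo_scale^~ x : a b / a + b}.
Proof.
by move=> a b; rewrite -[x]reprK -!pi_quo_scale scalerDl raddfD.
Qed.

HB.instance Definition _ := GRing.Zmodule_isLmodule.Build k quo
  quo_scaleA quo_scale1 quo_scaleDr quo_scaleDl.

Lemma pi_quo_linear : linear (\pi_quo : V -> quo).
Proof. by move=> a u v; rewrite -[a *: \pi_quo u]pi_quo_scale raddfD. Qed.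

(* The map induced on [quo] by [f]; meaningful when [f] is linear and kills
   [G], see [quo_liftE]. *)
Fact quo_lift_key : unit. Proof. by []. Qed.
Definition quo_lift (W : Type) (f : V -> W) : quo -> W :=
  locked_with quo_lift_key (fun x => f (repr x)).

Lemma quo_liftE (W : lmodType k) (f : V -> W) :
  linear f -> (forall v, G v -> f v = 0) ->
  forall v, quo_lift f (\pi_quo v) = f v.
Proof.
move=> lf fG v.
have f0 : f 0 = 0 by have := lf (-1) 0 0; rewrite scaler0 addr0 scaleN1r addNr.
suff /spanP[s Gs sE] : repr (\pi_quo v) - v \in gspan.
  have -> : quo_lift f (\pi_quo v) = f (1 *: (repr (\pi_quo v) - v) + v).
    by rewrite /quo_lift locked_withE scale1r subrK.
  rewrite lf scale1r sE -[RHS]add0r; congr (_ + _).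
  elim: s Gs {sE} => [|p s IHs] Gs; first by rewrite big_nil.
  rewrite big_cons lf fG ?scaler0 ?add0r; last by apply: Gs; rewrite mem_head.
  by apply: IHs => q qs; apply: Gs; rewrite inE qs orbT.
by apply/quo_eqP; rewrite reprK.
Qed.

Lemma quo_lift_linear (W : lmodType k) (f : V -> W) :
  linear f -> (forall v, G v -> f v = 0) -> linear (quo_lift f).
Proof.
move=> lf fG a x y; rewrite -[x]reprK -[y]reprK -pi_quo_linear.
by rewrite !quo_liftE //; apply: lf.
Qed.

End Span.

Section Tensor.
Variables (k : fieldType) (M N : lmodType k).

Local Notation "[: m , n :]" := (mkmalgU (m, n) (1 : k) : {malg k[(M * N)%type]}).

Inductive bilin_rel : set {malg k[(M * N)%type]} :=
| bilinDl m m' n : bilin_rel ([: m + m', n :] - [: m, n :] - [: m', n :])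
| bilinDr m n n' : bilin_rel ([: m, n + n' :] - [: m, n :] - [: m, n' :])
| bilinZl a m n : bilin_rel ([: a *: m, n :] - a *: [: m, n :])
| bilinZr a m n : bilin_rel ([: m, a *: n :] - a *: [: m, n :]).

Definition tens := quo bilin_rel.
HB.instance Definition _ := GRing.Lmodule.on tens.

Definition tmul (m : M) (n : N) : tens := \pi_(quo bilin_rel) [: m, n :].

Definition free_lift (W : lmodType k) (f : M -> N -> W)
    (g : {malg k[(M * N)%type]}) : W :=
  \sum_(p <- msupp g) g@_p *: f p.1 p.2.

(* The linear map with [m ⊗ n |-> f m n]; meaningful when [f] is bilinear,
   see [tliftE]. *)
Definition tlift (W : lmodType k) (f : M -> N -> W) : tens -> W :=
  quo_lift (free_lift f).

Lemma free_liftw (W : lmodType k) (f : M -> N -> W) g (d : {fset (M * N)%type}) :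
  (msupp g `<=` d)%fset -> free_lift f g = \sum_(p <- d) g@_p *: f p.1 p.2.
Proof.
move=> sd; rewrite /free_lift; apply: big_fset_incl => // p _ /mcoeff_outdom ->.
by rewrite scale0r.
Qed.

Lemma free_lift_linear (W : lmodType k) (f : M -> N -> W) :
  linear (free_lift f).
Proof.
move=> a g h; pose d := (msupp g `|` msupp h `|` msupp (a *: g + h))%fset.
rewrite !(@free_liftw _ _ _ d) /d ?fsubsetUr //; last 2 first.
- by apply: fsubset_trans (fsubsetUl _ _); apply: fsubsetUr.
- by apply: fsubset_trans (fsubsetUl _ _); apply: fsubsetUl.
rewrite scaler_sumr -big_split /=; apply: eq_bigr => p _.
by rewrite mcoeffD mcoeffZ scalerDl scalerA.
Qed.

Lemma free_liftU (W : lmodType k) (f : M -> N -> W) m n :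
  free_lift f [: m, n :] = f m n.
Proof.
by rewrite /free_lift msuppU oner_eq0 big_seq_fset1 mcoeffUU scale1r.
Qed.

Lemma free_lift_bilin (W : lmodType k) (f : M -> N -> W) :
  bilinear_for *:%R *:%R f -> forall g, bilin_rel g -> free_lift f g = 0.
Proof.
move=> [fl fr] g.
have L := free_lift_linear f.
have LZ a x : free_lift f (a *: x) = a *: free_lift f x.
  have := L a x 0; rewrite addr0 => ->.
  by rewrite {2}/free_lift msupp0 big_seq_fset0 addr0.
have LB x y : free_lift f (x - y) = free_lift f x - free_lift f y.
  by have := L (-1) y x; rewrite !scaleN1r ![- _ + _]addrC.
have f0l n : f 0 n = 0 by have /= := fl n (-1) 0 0; rewrite scaler0 addr0 scaleN1r addNr.
have f0r m : f m 0 = 0 by have /= := fr m (-1) 0 0; rewrite scaler0 addr0 scaleN1r addNr.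
case=> [m m' n|m n n'|a m n|a m n]; rewrite !LB ?LZ !free_liftU.
- by have /= := fl n 1 m m'; rewrite !scale1r => ->; rewrite addrAC addrK subrr.
- by have /= := fr m 1 n n'; rewrite !scale1r => ->; rewrite addrAC addrK subrr.
- by have /= := fl n a m 0; rewrite !addr0 => ->; rewrite f0l addr0 subrr.
- by have /= := fr m a n 0; rewrite !addr0 => ->; rewrite f0r addr0 subrr.
Qed.

Lemma tliftE (W : lmodType k) (f : M -> N -> W) :
  bilinear_for *:%R *:%R f -> forall m n, tlift f (tmul m n) = f m n.
Proof.
move=> bf m n; rewrite /tlift /tmul quo_liftE ?free_liftU //.
  exact: free_lift_linear.
exact: free_lift_bilin.
Qed.

Lemma tlift_linear (W : lmodType k) (f : M -> N -> W) :
  bilinear_for *:%R *:%R f -> linear (tlift f).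
Proof.
move=> bf; apply: quo_lift_linear; first exact: free_lift_linear.
exact: free_lift_bilin.
Qed.

Lemma tmul_bilinear : bilinear_for *:%R *:%R tmul.
Proof.
have E (V : zmodType) (x y z t : V) : x - (t + z) = (x - y - z) + (y - t).
  by rewrite addrA [x - y - z + y]addrAC subrK opprD addrA addrAC.
split=> [n|m] a x y; rewrite /tmul /= -pi_quo_linear; apply/quo_eqP.
  rewrite (E _ _ [: a *: x, n :]) rpredD //; apply: span_gen;
    by [apply: bilinDl | apply: bilinZl].
rewrite (E _ _ [: m, a *: x :]) rpredD //; apply: span_gen;
  by [apply: bilinDr | apply: bilinZr].
Qed.

Lemma tens_gen (x : tens) :
  exists s : seq (M * N), x = \sum_(p <- s) tmul p.1 p.2.
Proof.
rewrite -[x](@reprK _ (quo bilin_rel)); set g := repr _.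
exists [seq (g@_p *: p.1, p.2) | p <- msupp g].
rewrite {1}[g]monalgE raddf_sum big_map /=; apply: eq_bigr => -[m n] _ /=.
have [/(_ n (g@_(m, n)) m 0)/= bl _] := tmul_bilinear.
have t0 : tmul 0 n = 0.
  have [/(_ n (-1) 0 0)/= e _] := tmul_bilinear; rewrite scaler0 addr0 in e.
  by rewrite e scaleN1r addNr.
rewrite addr0 t0 addr0 in bl; rewrite bl /tmul.
have -> : << g@_(m, n) *g (m, n) >> = g@_(m, n) *: [: m, n :].
  by apply/malgP => q; rewrite mcoeffZ !mcoeffU mulrnAr mulr1.
by rewrite pi_quo_scale.
Qed.

End Tensor.

Arguments tens {k} (M N)%_type_scope.

Notation "M ⊗ N" := (tens M N) (at level 40, left associativity) : type_scope.
Notation "m ⊗ n" := (tmul m n) (at level 40, left associativity) : ring_scope.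

Section TensorMaps.
Variables (k : fieldType).
Implicit Types M N P Q : lmodType k.

Definition tmap M N P Q (f : M -> P) (g : N -> Q) : M ⊗ N -> P ⊗ Q :=
  tlift (fun m n => f m ⊗ g n).

Definition tassoc M N P : (M ⊗ N) ⊗ P -> M ⊗ (N ⊗ P) :=
  tlift (fun x p => tlift (fun m n => m ⊗ (n ⊗ p)) x).

End TensorMaps.

HB.mixin Record Lmodule_isCoalgebra (k : fieldType) C of GRing.Lmodule k C := {
  coprod : {linear C -> (C ⊗ C)%type};
  counit : {linear C -> k^o};
  coprodA : forall c : C,
    tassoc (tmap coprod (@id C) (coprod c)) = tmap (@id C) coprod (coprod c);
  counitl : forall c : C, tlift (fun x y : C => (counit x : k) *: y) (coprod c) = c;
  counitr : forall c : C, tlift (fun x y : C => (counit y : k) *: x) (coprod c) = c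
}.

#[short(type="coalgType")]
HB.structure Definition Coalgebra (k : fieldType) :=
  {C of GRing.Lmodule k C & Lmodule_isCoalgebra k C}.

Definition right_comodule (k : fieldType) (C : coalgType k) (M : lmodType k)
    (rho : {linear M -> (M ⊗ C)%type}) : Prop :=
  (forall m, tassoc (tmap rho (@id C) (rho m)) = tmap (@id M) coprod (rho m)) /\
  (forall m, tlift (fun (x : M) (c : C) => (counit c : k) *: x) (rho m) = m).

Section Extension.
Variables (k : fieldType) (A : algType k) (B : set A).

Inductive balanced_rel : set (A ⊗ A)%type :=
  BalancedRel a b a' of B b : balanced_rel ((a * b) ⊗ a' - a ⊗ (b * a')).

Definition tensB := quo balanced_rel.
HB.instance Definition _ := GRing.Lmodule.on tensB.

Definition tmulB (a a' : A) : tensB := \pi_(quo balanced_rel) (a ⊗ a').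

(* The linear map with [a ⊗_B a' |-> f a a']; meaningful when [f] is bilinear
   and B-balanced, see [tliftBE]. *)
Definition tliftB (W : lmodType k) (f : A -> A -> W) : tensB -> W :=
  quo_lift (tlift f).

Definition balanced (W : Type) (f : A -> A -> W) : Prop :=
  forall a b a', B b -> f (a * b) a' = f a (b * a').

Lemma tlift_balanced (W : lmodType k) (f : A -> A -> W) :
  bilinear_for *:%R *:%R f -> balanced f ->
  forall x, balanced_rel x -> tlift f x = 0.
Proof.
move=> bf balf _ [a b a' Bb]; rewrite addrC -scaleN1r tlift_linear //.
by rewrite !tliftE // scaleN1r balf // addNr.
Qed.

Lemma tliftBE (W : lmodType k) (f : A -> A -> W) :
  bilinear_for *:%R *:%R f -> balanced f ->
  forall a a', tliftB f (tmulB a a') = f a a'.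
Proof.
move=> bf balf a a'; rewrite /tliftB /tmulB quo_liftE ?tliftE //.
  exact: tlift_linear.
exact: tlift_balanced.
Qed.

Lemma tliftB_linear (W : lmodType k) (f : A -> A -> W) :
  bilinear_for *:%R *:%R f -> balanced f -> linear (tliftB f).
Proof.
move=> bf balf; apply: quo_lift_linear; first exact: tlift_linear.
exact: tlift_balanced.
Qed.

Lemma tmulB_bilinear : bilinear_for *:%R *:%R tmulB.
Proof.
have [tl tr] := tmul_bilinear A A.
by split=> [a'|a] c x y /=; rewrite /tmulB -pi_quo_linear;
  [rewrite tl | rewrite tr].
Qed.

Lemma tmulB_balanced : balanced tmulB.
Proof.
by move=> a b a' Bb; apply/quo_eqP; apply: span_gen; apply: BalancedRel.
Qed.

Lemma tensB_gen (x : tensB) :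
  exists s : seq (A * A), x = \sum_(p <- s) tmulB p.1 p.2.
Proof.
rewrite -[x](@reprK _ (quo balanced_rel)).
by have [s ->] := tens_gen (repr x); exists s; rewrite raddf_sum.
Qed.

Definition tensB_lact (a : A) : tensB -> tensB :=
  tliftB (fun x y => tmulB (a * x) y).

Definition tensB_ract (u : tensB) (a : A) : tensB :=
  tliftB (fun x y => tmulB x (y * a)) u.

Lemma tensB_lactE a x y : tensB_lact a (tmulB x y) = tmulB (a * x) y.
Proof.
have [tl tr] := tmulB_bilinear.
apply: (tliftBE (f := fun x y => tmulB (a * x) y)).
  by split=> [y'|x'] c u v /=; rewrite ?tr // mulrDr -scalerAr tl.
by move=> u b v Bb; rewrite mulrA tmulB_balanced.
Qed.

Lemma tensB_ractE x y a : tensB_ract (tmulB x y) a = tmulB x (y * a).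
Proof.
have [tl tr] := tmulB_bilinear.
apply: (tliftBE (f := fun x y => tmulB x (y * a))).
  by split=> [y'|x'] c u v /=; rewrite ?tl // mulrDl -scalerAl tr.
by move=> u b v Bb; rewrite -mulrA tmulB_balanced.
Qed.

Definition separability_idempotent (u : tensB) : Prop :=
  (forall a, tensB_lact a u = tensB_ract u a) /\
  tliftB (fun x y => x * y) u = 1.

Definition separable_ext : Prop := exists u, separability_idempotent u.

(* A map A -> B is a map A -> A with values in B; k-linearity is no
   restriction on a bimodule map, since B contains k. *)
Definition conditional_expectation (E : {linear A -> A}) : Prop :=
  [/\ forall a, B (E a),
      E 1 = 1,
      forall b a, B b -> E (b * a) = b * E a &
      forall a b, B b -> E (a * b) = E a * b].

Definition split_ext : Prop := exists E, conditional_expectation E.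

Definition strongly_separable : Prop :=
  [/\ separable_ext, split_ext &
      exists (u : tensB) (E : {linear A -> A}) (tau : k),
        [/\ separability_idempotent u, conditional_expectation E,
            tau \is a GRing.unit,
            forall a, tliftB (fun x y => E (a * x) * y) u = a * tau%:A &
            forall a, tliftB (fun x y => x * E (y * a)) u = a * tau%:A]].

(* Coefficients are written on the right of the basis elements; [b x] is the
   coefficient of [x], and its values outside the finite sequence [s] play no
   role. *)
Definition right_basis (X : set A) : Prop :=
  (forall a, exists (s : seq A) (b : A -> A),
     [/\ forall x, x \in s -> X x, forall x, B (b x) &
         a = \sum_(x <- s) x * b x]) /\
  (forall (s : seq A) (b : A -> A),
     uniq s -> (forall x, x \in s -> X x) -> (forall x, B (b x)) ->
     \sum_(x <- s) x * b x = 0 -> forall x, x \in s -> b x = 0).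

Definition right_free : Prop := exists X, right_basis X.

End Extension.

Section CoalgebraGalois.
Variables (k : fieldType) (C : coalgType k) (A : algType k).
Variable rho : {linear A -> (A ⊗ C)%type}.

Definition lact (a : A) : A ⊗ C -> A ⊗ C := tlift (fun x c => (a * x) ⊗ c).

Lemma lact_bilinear (a : A) :
  bilinear_for *:%R *:%R (fun (x : A) (c : C) => (a * x) ⊗ c).
Proof.
have [tl tr] := tmul_bilinear A C.
by split=> [c|x] l u v /=; rewrite ?tr // mulrDr -scalerAr tl.
Qed.

Lemma lactE a x c : lact a (x ⊗ c) = (a * x) ⊗ c.
Proof. exact/tliftE/lact_bilinear. Qed.

Lemma lact_linear a : linear (lact a).
Proof. exact/tlift_linear/lact_bilinear. Qed.

HB.instance Definition _ a :=
  GRing.isLinear.Build k (A ⊗ C)%type (A ⊗ C)%type *:%R (lact a) (lact_linear a).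

Lemma lactM a b y : lact (a * b) y = lact a (lact b y).
Proof.
have [s ->] := tens_gen y; rewrite !raddf_sum.
by apply: eq_bigr => p _; rewrite /= !lactE mulrA.
Qed.

Lemma lact1 y : lact 1 y = y.
Proof.
have [s ->] := tens_gen y; rewrite raddf_sum.
by apply: eq_bigr => p _; rewrite /= lactE mul1r.
Qed.

Lemma lactDZ l a b y : lact (l *: a + b) y = l *: lact a y + lact b y.
Proof.
have [tl _] := tmul_bilinear A C.
have [s ->] := tens_gen y; rewrite !raddf_sum -big_split /=.
by apply: eq_bigr => p _; rewrite !lactE mulrDl -scalerAl tl.
Qed.

Definition coinv : set A :=
  fun b => forall a, rho (b * a) = lact b (rho a).

Definition can : tensB coinv -> A ⊗ C := tliftB (fun a a' => lact a (rho a')).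

Lemma coinv_subalg :
  [/\ coinv 1,
      forall (l : k) a b, coinv a -> coinv b -> coinv (l *: a + b) &
      forall a b, coinv a -> coinv b -> coinv (a * b)].
Proof.
split=> [a|l a b Ba Bb x|a b Ba Bb x]; first by rewrite mul1r lact1.
  by rewrite mulrDl -scalerAl linearP Ba Bb lactDZ.
by rewrite -mulrA Ba Bb lactM.
Qed.

Lemma can_bilinear :
  bilinear_for *:%R *:%R (fun a a' => lact a (rho a')).
Proof.
by split=> [a'|a] l u v /=; [apply: lactDZ | rewrite !linearP].
Qed.

Lemma can_balanced : balanced coinv (fun a a' => lact a (rho a')).
Proof. by move=> a b a' Bb; rewrite Bb lactM. Qed.

Lemma canE a a' : can (tmulB coinv a a') = lact a (rho a').
Proof. exact: tliftBE can_bilinear can_balanced _ _. Qed.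

Lemma can_linear : linear can.
Proof. exact: tliftB_linear can_bilinear can_balanced. Qed.

Definition coalgebra_galois : Prop := bijective can.

(* The inverse of [can] when [coalgebra_galois] holds, see [can_invK]. *)
Definition can_inv (y : A ⊗ C) : tensB coinv := xget 0 [set x | can x = y]%classic.

Lemma can_invK : coalgebra_galois -> cancel can can_inv /\ cancel can_inv can.
Proof.
move=> [g gK Kg].
have K y : can (can_inv y) = y.
  by apply: (@xgetPex _ 0 [set x | can x = y]%classic); exists (g y); exact: Kg.
by split=> // x; apply: (can_inj gK); rewrite K.
Qed.

Definition entw : C ⊗ A -> A ⊗ C :=
  tlift (fun c a => can (tensB_ract (can_inv (1 ⊗ c)) a)).

Lemma tensB_ract_linear a : linear (tensB_ract (B := coinv) ^~ a).
Proof.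
have [tl tr] := tmulB_bilinear coinv.
apply: (tliftB_linear (f := fun x y => tmulB coinv x (y * a))).
  by split=> [y'|x'] c u v /=; rewrite ?tl // mulrDl -scalerAl tr.
by move=> u b v Bb; rewrite -mulrA tmulB_balanced.
Qed.

Lemma tensB_ract_can_inv_bilinear : coalgebra_galois ->
  bilinear_for *:%R *:%R (fun c a => can (tensB_ract (can_inv (1 ⊗ c)) a)).
Proof.
move=> /can_invK[cK cK'].
have [_ tr] := tmul_bilinear A C.
have [tBl tBr] := tmulB_bilinear coinv.
have ci_lin : linear can_inv.
  by move=> l u v; apply: (can_inj cK); rewrite can_linear !cK'.
split=> [a|c] l u v /=.
  by rewrite tr ci_lin tensB_ract_linear can_linear.
rewrite -can_linear; congr can.
have [s ->] := tensB_gen (can_inv (1 ⊗ c)).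
have rsum a : tensB_ract (\sum_(p <- s) tmulB coinv p.1 p.2) a =
              \sum_(p <- s) tmulB coinv p.1 (p.2 * a).
  pose f : {linear _ -> _} := HB.pack (tensB_ract (B := coinv) ^~ a)
    (GRing.isLinear.Build k _ _ *:%R _ (tensB_ract_linear a)).
  rewrite -[LHS]/(f _) raddf_sum.
  by apply: eq_bigr => p _; rewrite /= tensB_ractE.
rewrite !rsum scaler_sumr -big_split /=.
by apply: eq_bigr => p _; rewrite mulrDr -scalerAr tBr.
Qed.

Lemma entwE : coalgebra_galois ->
  forall c a, entw (c ⊗ a) = can (tensB_ract (can_inv (1 ⊗ c)) a).
Proof. by move=> g c a; apply/tliftE/tensB_ract_can_inv_bilinear. Qed.

Definition integral (z : A ⊗ C) : Prop :=
  forall a, lact a z = tlift (fun x c => lact x (entw (c ⊗ a))) z.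

Definition normalised (z : A ⊗ C) : Prop :=
  tlift (fun (x : A) (c : C) => (counit c : k) *: x) z = 1.

End CoalgebraGalois.

(* Main.v *)
Require Import Defs.
From HB Require Import structures.
From mathcomp Require Import all_boot all_algebra falgebra.
From mathcomp Require Import boolp classical_sets.

Set Implicit Arguments.
Unset Strict Implicit.

Import GRing.Theory.
Local Open Scope ring_scope.

(** Both sides of the equivalence are the same data, transported along the
    bijection [can : A ⊗_B A -> A ⊗ C], where [B] is the subalgebra of
    coinvariants.

    [can] is left [A]-linear, and it turns right multiplication on [A ⊗_B A]
    into the right [A]-action [(x ⊗ c) a = x ψ(c ⊗ a)] ([can_ract]); composing
    it with the counit on [C] gives the product of [A].  Hence [z = can u] is
    a normalised integral exactly when [u] is a separability idempotent
    ([integral_can], [normalised_can]).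

    Since [can (1 ⊗ a) = ρ(a)], a left [B]-linear map [E : A -> A] is the same
    thing as a linear map [φ : C -> A], the two being related by
    [E(a) = a_0 φ(a_1)], or equivalently by
    [φ(c) = c' E(c'')] when [can^-1(1 ⊗ c)] is [c' ⊗ c''].  Under this
    correspondence (i) says that [E] takes values in [B], (ii) that
    [E(1) = 1], and (iii) that [E] is right [B]-linear
    ([conditional_expectationP]).  Moreover [Σ u_i E(u^i)] is the value of
    [x ⊗ c |-> x φ(c)] at [z]; and because [u] is central,
    [Σ u_i E(u^i a) = a (Σ u_i E(u^i))].  So the condition on [τ] amounts to
    the second of the two equations of strong separability.

    It remains to deduce the first equation from the second, and this is where
    freeness and finite dimension enter ([dual_basis_sym]).  The second
    equation says that the [u_i] and the functionals [τ^-1 E(u^i -)] form a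
    dual basis of the right [B]-module [A], so that every right [B]-linear
    functional [A -> B] has the form [E(g -)].  If [x_1, ..., x_n] is a basis
    of [A] over [B], the map [g |-> Σ x_j E(g x_j)] is therefore a surjective
    [k]-linear endomorphism of the finite-dimensional space [A], thus
    injective, so [E(g A) = 0] forces [g = 0].  Both
    [Σ E(u_i) u^i] and [τ] give the functional [τ E], so they are equal. *)

(** * Linear maps on tensor products *)

Section LinearMaps.
Variable k : fieldType.

Lemma linear_big {U V : lmodType k} {f : U -> V} : linear f ->
  forall (I : Type) (s : seq I) (F : I -> U),
    f (\sum_(i <- s) F i) = \sum_(i <- s) f (F i).
Proof.
move=> lf I s F; pose g : {linear U -> V} :=
  HB.pack f (GRing.isLinear.Build k U V *:%R f lf).
exact: (raddf_sum g).
Qed.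

Lemma linear_comp {U V W : lmodType k} {f : V -> W} {g : U -> V} :
  linear f -> linear g -> linear (f \o g).
Proof. by move=> lf lg a u v; rewrite /= lg lf. Qed.

(** Stated for bare functions with a linearity proof, because the maps compared
    below ([tlift], [tmap], [can] and their composites) are bare functions. *)
Lemma linear_tens_ext {M N W : lmodType k} {f g : (M ⊗ N)%type -> W} :
  linear f -> linear g -> (forall m n, f (m ⊗ n) = g (m ⊗ n)) -> f =1 g.
Proof.
move=> lf lg fg y; have [s ->] := tens_gen y.
by rewrite !linear_big //; apply: eq_bigr => p _; apply: fg.
Qed.

Lemma linear_tensB_ext {A : algType k} {B : set A} {W : lmodType k}
    {f g : tensB B -> W} :
  linear f -> linear g -> (forall x y, f (tmulB B x y) = g (tmulB B x y)) ->
  f =1 g.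
Proof.
move=> lf lg fg u; have [s ->] := tensB_gen u.
by rewrite !linear_big //; apply: eq_bigr => p _; apply: fg.
Qed.

Lemma tmap_bilinear {M N P Q : lmodType k} {f : M -> P} {g : N -> Q} :
  linear f -> linear g -> bilinear_for *:%R *:%R (fun m n => f m ⊗ g n).
Proof.
have [tl tr] := tmul_bilinear P Q => lf lg.
by split=> [n|m] a u v /=; rewrite ?lf ?lg ?tl ?tr.
Qed.

Lemma tmapE {M N P Q : lmodType k} {f : M -> P} {g : N -> Q} :
  linear f -> linear g -> forall m n, tmap f g (m ⊗ n) = f m ⊗ g n.
Proof. by move=> lf lg m n; apply/tliftE/tmap_bilinear. Qed.

Lemma tmap_linear {M N P Q : lmodType k} {f : M -> P} {g : N -> Q} :
  linear f -> linear g -> linear (tmap f g).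
Proof. by move=> lf lg; apply/tlift_linear/tmap_bilinear. Qed.

Lemma linear_id {M : lmodType k} : linear (@id M).
Proof. by []. Qed.

Lemma tassoc_inner_bilinear {M N P : lmodType k} (p : P) :
  bilinear_for *:%R *:%R (fun (m : M) (n : N) => m ⊗ (n ⊗ p)).
Proof.
have [tl _] := tmul_bilinear N P; have [tl' tr'] := tmul_bilinear M (N ⊗ P)%type.
by split=> [n|m] a u v /=; rewrite ?tl ?tl' ?tr'.
Qed.

Lemma tassoc_bilinear {M N P : lmodType k} :
  bilinear_for *:%R *:%R
    (fun x (p : P) => tlift (fun (m : M) (n : N) => m ⊗ (n ⊗ p)) x).
Proof.
have [_ tr] := tmul_bilinear N P; have [_ tr'] := tmul_bilinear M (N ⊗ P)%type.
split=> [p|x] a u v /=; first exact/tlift_linear/tassoc_inner_bilinear.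
pose F (p : P) := tlift (fun (m : M) (n : N) => m ⊗ (n ⊗ p)).
have FE p m n : F p (m ⊗ n) = m ⊗ (n ⊗ p).
  exact: (tliftE (tassoc_inner_bilinear p)).
have FL p : linear (F p) by apply/tlift_linear/tassoc_inner_bilinear.
have comb : linear (fun x => a *: F u x + F v x).
  move=> l y z; rewrite !FL !scalerDr !scalerA [a * l]mulrC.
  by rewrite addrACA.
apply: (linear_tens_ext (FL (a *: u + v)) comb) => m n.
by rewrite !FE tr tr'.
Qed.

Lemma tassocE {M N P : lmodType k} (m : M) (n : N) (p : P) :
  tassoc ((m ⊗ n) ⊗ p) = m ⊗ (n ⊗ p).
Proof.
by rewrite /tassoc (tliftE tassoc_bilinear) (tliftE (tassoc_inner_bilinear p)).
Qed.

Lemma tassoc_linear {M N P : lmodType k} : linear (@tassoc k M N P : _ -> _).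
Proof. exact/tlift_linear/tassoc_bilinear. Qed.

Lemma mul_bilinear {U : lmodType k} {A : algType k} {f : U -> A} {V : lmodType k}
    {h : V -> A} :
  linear f -> linear h -> bilinear_for *:%R *:%R (fun u v => f u * h v).
Proof.
move=> lf lh; split=> [v|u] a x y /=.
  by rewrite lf mulrDl scalerAl.
by rewrite lh mulrDr scalerAr.
Qed.

Lemma mulr_linear {A : algType k} (a : A) : linear (fun x : A => a * x).
Proof. by move=> l x y; rewrite mulrDr scalerAr. Qed.

Lemma mull_linear {A : algType k} (a : A) : linear (fun x : A => x * a).
Proof. by move=> l x y; rewrite mulrDl scalerAl. Qed.

Lemma mul_balancedr {A : algType k} {B : set A} {f : A -> A} :
  (forall b a, B b -> f (b * a) = b * f a) -> balanced B (fun x y => x * f y).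
Proof. by move=> fB a b a' Bb; rewrite (fB _ _ Bb) mulrA. Qed.

Lemma mul_balancedl {A : algType k} {B : set A} {f : A -> A} :
  (forall a b, B b -> f (a * b) = f a * b) -> balanced B (fun x y => f x * y).
Proof. by move=> fB a b a' Bb; rewrite (fB _ _ Bb) mulrA. Qed.

Lemma tliftB_sum {A : algType k} {B : set A} {W : lmodType k} {f : A -> A -> W} :
  bilinear_for *:%R *:%R f -> balanced B f -> forall t : seq (A * A),
  tliftB f (\sum_(p <- t) tmulB B p.1 p.2) = \sum_(p <- t) f p.1 p.2.
Proof.
move=> bf balf t; rewrite (linear_big (tliftB_linear bf balf)).
by apply: eq_bigr => p _; apply: (tliftBE bf balf).
Qed.

End LinearMaps.

(** * One-sided dual bases over a subalgebra *)

Section DualBasis.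
Variables (k : fieldType) (A : falgType k) (B : set A).
Hypothesis B1 : B 1.
Hypothesis Blin : forall (l : k) a b, B a -> B b -> B (l *: a + b).
Hypothesis BM : forall a b, B a -> B b -> B (a * b).

Lemma sub_closedD a b : B a -> B b -> B (a + b).
Proof. by move=> Ba Bb; have := Blin 1 Ba Bb; rewrite scale1r. Qed.

Lemma sub_closed0 : B 0.
Proof. by have := Blin (-1) B1 B1; rewrite scaleN1r addNr. Qed.

Lemma sub_closed_sum (I : Type) (s : seq I) (F : I -> A) :
  (forall i, B (F i)) -> B (\sum_(i <- s) F i).
Proof.
move=> BF; elim/big_rec: _ => [|i x _ Bx]; first exact: sub_closed0.
exact: sub_closedD.
Qed.

(** Independence is expressed as uniqueness of coefficients, the form in which
    it makes the coefficient maps linear. *)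
Definition right_basis_seq (s : seq A) : Prop :=
  [/\ uniq s,
   (forall a, exists2 b : A -> A, forall x, B (b x) & a = \sum_(x <- s) x * b x) &
   (forall b b' : A -> A, (forall x, B (b x)) -> (forall x, B (b' x)) ->
     \sum_(x <- s) x * b x = \sum_(x <- s) x * b' x ->
     forall x, x \in s -> b x = b' x)].

(** Finitely many elements of the given basis suffice to write the vectors of a
    [k]-basis of [A]; together they generate [A], and they stay independent. *)
Lemma right_free_finite : right_free B -> exists s, right_basis_seq s.
Proof.
case=> X [Xgen Xfree].
have /choice[f fP] (i : 'I_(\dim {: A})) :
    exists s : seq A, (forall x, x \in s -> X x) /\
      exists2 b : A -> A, forall x, B (b x) &
        (vbasis {: A})`_i = \sum_(x <- s) x * b x.
  by have [s [b [sX bB e]]] := Xgen (vbasis {: A})`_i; exists s; split=> //; exists b.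
pose s := undup (flatten [seq f i | i <- enum 'I_(\dim {: A})]).
have us : uniq s by apply: undup_uniq.
have sX x : x \in s -> X x.
  by rewrite mem_undup => /flattenP[_ /mapP[i _ ->]]; case: (fP i) => + _; apply.
exists s; split=> // [a|b b' bB b'B e x xs]; last first.
  apply/eqP; rewrite -subr_eq0; apply/eqP.
  apply: (Xfree s (fun x => b x - b' x)) => // [y|].
    by rewrite addrC -scaleN1r; apply: Blin.
  by under eq_bigr do rewrite mulrBr; rewrite sumrB e subrr.
pose gen (v : A) := exists2 b : A -> A, forall x, B (b x) & v = \sum_(x <- s) x * b x.
have gen0 : gen 0.
  exists (fun=> 0) => [_|]; first exact: sub_closed0.
  by rewrite big1 // => y _; rewrite mulr0.
have genP l u v : gen u -> gen v -> gen (l *: u + v).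
  move=> [b bB ->] [c cB ->]; exists (fun x => l *: b x + c x) => [x|].
    exact: Blin.
  rewrite scaler_sumr -big_split; apply: eq_bigr => y _ /=.
  by rewrite mulrDr scalerAr.
rewrite -/(gen a) (coord_vbasis (memvf a)).
elim/big_rec: _ => [|i v _]; first exact: gen0.
apply: (genP _ _ _); case: (fP i) => _ [b bB ->].
have : {subset f i <= s}.
  move=> x xi; rewrite mem_undup; apply/flattenP; exists (f i) => //.
  by apply: map_f; rewrite mem_enum.
elim: (f i) => [|x t IHt] ts; first by rewrite big_nil; apply: gen0.
rewrite big_cons -[_ * _]scale1r; apply: (genP _ _ _); last first.
  by apply: IHt => y yt; apply: ts; rewrite inE yt orbT.
exists (fun y => if y == x then b x else 0) => [y|].
  by case: ifP => _ //; apply: sub_closed0.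
have xs : x \in s by apply: ts; rewrite mem_head.
rewrite (bigD1_seq x) //= eqxx big1 ?addr0 // => y /negPf->.
by rewrite mulr0.
Qed.

Variables (E : {linear A -> A}) (t : seq (A * A)) (tau : k).
Hypothesis tau0 : tau != 0.
Hypothesis EP : conditional_expectation B E.
Hypothesis dualbasis : forall a, \sum_(p <- t) p.1 * E (p.2 * a) = tau *: a.

(** A right [B]-linear [f : A -> B] with [f x = b x] on the basis exists, and
    the dual basis [(p.1, τ^-1 E(p.2 -))] shows that it is [E(g -)] with
    [g = τ^-1 Σ f(p.1) p.2]. *)
Lemma expectation_extends {s : seq A} (b : A -> A) :
  right_basis_seq s -> (forall x, B (b x)) ->
  exists g, forall x, x \in s -> E (g * x) = b x.
Proof.
move=> [us sgen sfree] bB; have [EB _ EBl EBr] := EP.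
have /choice[co coP] (a : A) : exists c : A -> A,
    (forall x, B (c x)) /\ a = \sum_(x <- s) x * c x.
  by have [c cB e] := sgen a; exists c.
have coB a x : B (co a x) by case: (coP a).
have coE a : a = \sum_(x <- s) x * co a x by case: (coP a).
have coM a c x : B c -> x \in s -> co (a * c) x = co a x * c.
  move=> Bc.
  apply: (sfree (co (a * c)) (fun x => co a x * c)) => // [y|]; first exact: BM.
  rewrite -coE [a in LHS]coE mulr_suml; apply: eq_bigr => y _.
  by rewrite mulrA.
have coL l u v x : x \in s -> co (l *: u + v) x = l *: co u x + co v x.
  apply: (sfree (co (l *: u + v)) (fun x => l *: co u x + co v x)) => // [y|].
    exact: Blin.
  rewrite -coE [u in LHS]coE [v in LHS]coE scaler_sumr -big_split.
  by apply: eq_bigr => y _ /=; rewrite mulrDr scalerAr.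
pose f a := \sum_(x <- s) b x * co a x.
have fB a : B (f a) by apply: sub_closed_sum => x; apply: BM.
have fl : linear f.
  move=> l u v; rewrite /f scaler_sumr -big_split !big_seq.
  by apply: eq_bigr => y ys /=; rewrite coL // mulrDr scalerAr.
have fM a c : B c -> f (a * c) = f a * c.
  move=> Bc; rewrite /f mulr_suml !big_seq.
  by apply: eq_bigr => y ys /=; rewrite coM // mulrA.
exists (tau^-1 *: \sum_(p <- t) f p.1 * p.2) => x xs.
suff -> : b x = f x.
  rewrite -scalerAl mulr_suml linearZ raddf_sum /=.
  have -> : f x = tau^-1 *: f (tau *: x).
    have := fl tau x 0; have := fl (-1) 0 0.
    rewrite scaler0 addr0 scaleN1r addNr => ->; rewrite !addr0 => ->.
    by rewrite scalerA mulVf // scale1r.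
  rewrite -dualbasis (linear_big fl); congr (_ *: _).
  by apply: eq_bigr => p _; rewrite -mulrA EBl // fM.
have cox y : y \in s -> co x y = (y == x)%:R.
  apply: (sfree (co x) (fun y => (y == x)%:R)) => // [y'|].
    by case: eqP => _ //; apply: sub_closed0.
  rewrite -coE (bigD1_seq x) //= eqxx mulr1 big1 ?addr0 // => z /negPf->.
  by rewrite mulr0.
rewrite /f (bigD1_seq x) //= cox // eqxx mulr1 big_seq_cond big1 ?addr0 // => y.
by case/andP=> ys /negPf yx; rewrite cox // yx mulr0.
Qed.

(** The map [g |-> Σ x E(g x)] is onto, since functionals may be prescribed on
    a basis; being an endomorphism of a finite-dimensional space, it is
    injective, and it kills [a]. *)
Lemma expectation_nondegenerate :
  right_free B -> forall a, (forall x, E (a * x) = 0) -> a = 0.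
Proof.
move=> /right_free_finite[s sP] a Ea0.
have [_ sgen _] := sP.
pose L (g : A) := \sum_(x <- s) x * E (g * x).
have LL : linear L.
  move=> l u v; rewrite /L scaler_sumr -big_split; apply: eq_bigr => x _ /=.
  by rewrite mulrDl -scalerAl linearP mulrDr scalerAr.
pose h := linfun (HB.pack L (GRing.isLinear.Build k A A *:%R L LL) : {linear A -> A}).
have hE g : h g = L g by rewrite lfunE.
have himg : limg h = fullv.
  apply/eqP; rewrite eqEsubv subvf; apply/subvP => c _.
  have [b bB ->] := sgen c; have [g gP] := expectation_extends sP bB.
  suff -> : \sum_(x <- s) x * b x = h g by apply: memv_img; apply: memvf.
  by rewrite hE /L !big_seq; apply: eq_bigr => x xs; rewrite gP.
have ker0 : lker h = 0%VS.
  apply/eqP; rewrite -dimv_eq0; have := limg_ker_dim h fullv.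
  by rewrite himg capfv -[X in _ = X]add0n => /eqP; rewrite eqn_add2r.
apply/eqP; rewrite -memv0 -ker0 memv_ker hE /L big1 // => x _.
by rewrite Ea0 mulr0.
Qed.

(** Two elements [g] are equal when their functionals [E(g -)] are, and as [E] is a
    [B]-bimodule map,
    [E(E(p.1) p.2 x) = E(p.1) E(p.2 x) = E(p.1 E(p.2 x))]. *)
Lemma dual_basis_sym :
  right_free B -> \sum_(p <- t) E p.1 * p.2 = tau%:A.
Proof.
move=> freeB; have [EB _ EBl EBr] := EP.
apply/eqP; rewrite -subr_eq0; apply/eqP.
apply: expectation_nondegenerate => // x.
rewrite mulrBl raddfB /= mulr_suml raddf_sum /= -scalerAl mul1r -dualbasis.
rewrite raddf_sum -sumrB big1 // => p _ /=.
by rewrite -mulrA EBl // (EBr p.1) // subrr.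
Qed.

End DualBasis.

(** * The entwining structure *)

Section Entwining.
Variables (k : fieldType) (C : coalgType k) (A : algType k).
Variable rho : {linear A -> (A ⊗ C)%type}.

Lemma lact_linear_bilinear {U V : lmodType k} {f : U -> A} {h : V -> (A ⊗ C)%type} :
  linear f -> linear h -> bilinear_for *:%R *:%R (fun u v => lact (f u) (h v)).
Proof.
move=> lf lh; split=> [v|u] l x y /=; first by rewrite lf lactDZ.
by rewrite lh linearP.
Qed.

Local Notation B := (coinv rho).
Local Notation canr := (can (rho := rho)).

Lemma tensB_lact_linear a : linear (tensB_lact (B := B) a).
Proof.
have [tl tr] := tmulB_bilinear B.
apply: (tliftB_linear (f := fun x y => tmulB B (a * x) y)).
  by split=> [y'|x'] c u v /=; rewrite ?tr // mulrDr -scalerAr tl.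
by move=> u b v Bb; rewrite mulrA tmulB_balanced.
Qed.

Lemma tensB_ract_lact x v a :
  tensB_ract (tensB_lact (B := B) x v) a = tensB_lact x (tensB_ract v a).
Proof.
have L := tensB_lact_linear x; have R := tensB_ract_linear (rho := rho) a.
apply: (linear_tensB_ext (linear_comp R L) (linear_comp L R)) => y z /=.
by rewrite tensB_lactE !tensB_ractE tensB_lactE.
Qed.

Lemma can_lact x v : canr (tensB_lact x v) = lact x (canr v).
Proof.
have L := tensB_lact_linear x; have K := can_linear (rho := rho).
apply: (linear_tensB_ext (linear_comp K L) (linear_comp (lact_linear x) K)) => y z /=.
by rewrite tensB_lactE !canE lactM.
Qed.

Hypothesis canP : coalgebra_galois rho.

Let canK : cancel canr (@can_inv k C A rho) := (can_invK canP).1.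
Let can_invKr : cancel (@can_inv k C A rho) canr := (can_invK canP).2.

Lemma can_inv_linear : linear (@can_inv k C A rho).
Proof.
by move=> l u v; apply: (can_inj canK); rewrite can_linear !can_invKr.
Qed.

Lemma can_inv_tmul x c :
  can_inv rho (x ⊗ c) = tensB_lact x (can_inv rho (1 ⊗ c)).
Proof. by apply: (can_inj canK); rewrite can_lact !can_invKr lactE mulr1. Qed.

Lemma entw_linear : linear (entw rho).
Proof. exact/tlift_linear/tensB_ract_can_inv_bilinear. Qed.

Lemma entw_linearl a : linear (fun c : C => entw rho (c ⊗ a)).
Proof. by have [tl _] := tmul_bilinear C A => l u v; rewrite tl entw_linear. Qed.

(** The right [A]-action on [A ⊗ C] given by the entwining map. *)
Definition entw_ract (z : (A ⊗ C)%type) (a : A) : (A ⊗ C)%type :=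
  tlift (fun x c => lact x (entw rho (c ⊗ a))) z.

Let entw_ract_bilinear a := lact_linear_bilinear (@linear_id k A) (entw_linearl a).

Lemma entw_ractE x c a : entw_ract (x ⊗ c) a = lact x (entw rho (c ⊗ a)).
Proof. exact: (tliftE (entw_ract_bilinear a)). Qed.

Lemma entw_ract_linear a : linear (entw_ract^~ a).
Proof. exact: (tlift_linear (entw_ract_bilinear a)). Qed.

(** On [x ⊗ c] this is the definition of the canonical entwining, by left
    linearity of [can]. *)
Lemma can_ract u a : canr (tensB_ract u a) = entw_ract (canr u) a.
Proof.
rewrite -[in LHS](canK u); move: (canr u) => z; move: z.
have R := tensB_ract_linear (rho := rho) a.
have I := can_inv_linear; have K := can_linear (rho := rho).
apply: (linear_tens_ext (linear_comp K (linear_comp R I)) (entw_ract_linear a)).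
move=> x c /=.
by rewrite can_inv_tmul tensB_ract_lact can_lact entw_ractE entwE.
Qed.

Lemma can_inv_rho a : can_inv rho (rho a) = tmulB B 1 a.
Proof. by apply: (can_inj canK); rewrite can_invKr canE lact1. Qed.

(** [A] is an entwined module: [ρ(a) = can(1 ⊗ a)], and [can] is right
    [A]-linear. *)
Lemma rhoM a b : rho (a * b) = entw_ract (rho a) b.
Proof.
by rewrite -[rho a]can_invKr -can_ract can_inv_rho tensB_ractE canE lact1.
Qed.

Lemma entw_ract_lact x z a : entw_ract (lact x z) a = lact x (entw_ract z a).
Proof.
by rewrite -[z]can_invKr -can_lact -!can_ract tensB_ract_lact can_lact.
Qed.

(** The defining identity [ρ(b a) = b ρ(a)] need only be checked at [a = 1],
    since [ρ(a)] is obtained from [ρ(1)] by the right action of [a]. *)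
Lemma coinv1P b : B b <-> rho b = lact b (rho 1).
Proof.
split=> [Bb|rb a]; first by rewrite -{1}[b]mulr1 Bb.
by rewrite rhoM rb entw_ract_lact -rhoM mul1r.
Qed.

Lemma integral_can u :
  integral rho (canr u) <-> (forall a, tensB_lact a u = tensB_ract u a).
Proof.
split=> iu a.
  apply: (can_inj canK).
  exact: (etrans (can_lact a u) (etrans (iu a) (esym (can_ract u a)))).
by rewrite -(can_lact a u) (iu a) (can_ract u a).
Qed.

Lemma counit_bilinear :
  bilinear_for *:%R *:%R (fun (x : A) (c : C) => (counit c : k) *: x).
Proof.
split=> [c|x] l u v /=; first by rewrite scalerDr !scalerA mulrC.
by rewrite linearP scalerDl scalerA.
Qed.

(** The counit on [C] turns [can(x ⊗ y) = x y_0 ⊗ y_1] into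
    [x y_0 ε(y_1) = x y]. *)
Lemma normalised_can u : right_comodule rho ->
  normalised (canr u) <-> tliftB (fun x y => x * y) u = 1.
Proof.
move=> [_ rho_counit]; rewrite /normalised.
have bm : bilinear_for *:%R *:%R (fun x y : A => x * y) :=
  mul_bilinear (@linear_id k A) (@linear_id k A).
have balm : balanced B (fun x y => x * y) by move=> a b a' _; rewrite mulrA.
suff -> : tliftB (fun x y => x * y) u =
  tlift (fun (x : A) (c : C) => (counit c : k) *: x) (canr u) by [].
have N := tlift_linear counit_bilinear.
apply: (linear_tensB_ext (tliftB_linear bm balm) (linear_comp N (can_linear (rho := rho)))).
move=> x y /=; rewrite canE (tliftBE bm balm) -{1}[y]rho_counit.
apply: (linear_tens_ext (linear_comp (mulr_linear x) N) (linear_comp N (lact_linear x))).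
move=> y' c /=; rewrite (lactE x y' c).
rewrite (tliftE counit_bilinear y' c) (tliftE counit_bilinear (x * y') c).
by rewrite (scalerAr _ x y').
Qed.

(** * Conditional expectations and maps out of the coalgebra *)

Definition ev (phi : C -> A) : (A ⊗ C)%type -> A := tlift (fun a c => a * phi c).

Section Evaluation.
Variable phi : {linear C -> A}.

Let ev_bilinear : bilinear_for *:%R *:%R (fun (a : A) (c : C) => a * phi c) :=
  mul_bilinear (@linear_id k A) (linearP phi).

Lemma evE x c : ev phi (x ⊗ c) = x * phi c.
Proof. exact: (tliftE ev_bilinear). Qed.

Lemma ev_linear : linear (ev phi).
Proof. exact: (tlift_linear ev_bilinear). Qed.

Lemma ev_lact x z : ev phi (lact x z) = x * ev phi z.
Proof.
apply: (linear_tens_ext (linear_comp ev_linear (lact_linear x))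
  (linear_comp (mulr_linear x) ev_linear)) => y c /=.
by rewrite lactE !evE mulrA.
Qed.

Lemma ev_can x y : ev phi (canr (tmulB B x y)) = x * ev phi (rho y).
Proof. by rewrite canE ev_lact. Qed.

(** The elements [x ρ(y)] span [A ⊗ C], because [can] is onto. *)
Lemma can_ext {W : lmodType k} {f g : (A ⊗ C)%type -> W} :
  linear f -> linear g ->
  (forall x y, f (lact x (rho y)) = g (lact x (rho y))) -> f =1 g.
Proof.
move=> lf lg fg z; rewrite -[z]can_invKr; move: (can_inv rho z).
have K := can_linear (rho := rho).
apply: (linear_tensB_ext (linear_comp lf K) (linear_comp lg K)) => x y /=.
by rewrite canE.
Qed.

(** The left-hand side [ψ(c_1 ⊗ φ(c_2))] of condition (i). *)
Definition entw_coprod (c : C) : (A ⊗ C)%type := entw rho (tmap (@id C) phi (coprod c)).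

Let tphi_linear := tmap_linear (@linear_id k C) (linearP phi).

Lemma entw_coprod_linear : linear entw_coprod.
Proof. by move=> l u v; rewrite /entw_coprod linearP tphi_linear entw_linear. Qed.

Let entw_coprod_bilinear := lact_linear_bilinear (@linear_id k A) entw_coprod_linear.

(** [ρ(a_0 φ(a_1)) = a_0 ψ(a_1 ⊗ φ(a_2))], by [rhoM] and coassociativity. *)
Lemma rho_ev_rho a : right_comodule rho ->
  rho (ev phi (rho a)) = tlift (fun x c => lact x (entw_coprod c)) (rho a).
Proof.
move=> [rho_coassoc _].
have Lentw : linear (fun y => entw rho (tmap (@id C) phi y)).
  by move=> l u v; rewrite tphi_linear entw_linear.
have bT := lact_linear_bilinear (@linear_id k A) Lentw.
(* T sends x ⊗ (c ⊗ d) to x ψ(c ⊗ φ(d)); coassociativity is applied under T. *)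
pose T := tlift (fun x y => lact (id x) (entw rho (tmap (@id C) phi y))).
have TL : linear T := tlift_linear bT.
have TE x y : T (x ⊗ y) = lact x (entw rho (tmap (@id C) phi y)).
  exact: (tliftE bT).
have rid := tmap_linear (linearP rho) (@linear_id k C).
have idD := tmap_linear (@linear_id k A) (linearP (@coprod k C)).
have -> : tlift (fun x c => lact x (entw_coprod c)) (rho a) =
    T (tmap (@id A) coprod (rho a)).
  apply: (linear_tens_ext (tlift_linear entw_coprod_bilinear) (linear_comp TL idD)).
  move=> x c /=; rewrite (tliftE entw_coprod_bilinear).
  by rewrite (tmapE (@linear_id k A) (linearP (@coprod k C))) TE.
rewrite -rho_coassoc.
have L1 := linear_comp (linearP rho) ev_linear.
have L2 := linear_comp TL (linear_comp (@tassoc_linear k A C C) rid).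
apply: (linear_tens_ext L1 L2) => x c /=.
rewrite evE rhoM (tmapE (linearP rho) (@linear_id k C)) /=.
have [tl _] := tmul_bilinear (A ⊗ C)%type C.
have Lc : linear (fun z : (A ⊗ C)%type => z ⊗ c) by move=> l u v; rewrite tl.
apply: (linear_tens_ext (entw_ract_linear (phi c))
  (linear_comp TL (linear_comp (@tassoc_linear k A C C) Lc))) => y d /=.
by rewrite entw_ractE tassocE TE (tmapE (@linear_id k C) (linearP phi)).
Qed.

Variable E : {linear A -> A}.
Hypothesis evE_rho : forall a, E a = ev phi (rho a).

Lemma expectation_Bl b a : B b -> E (b * a) = b * E a.
Proof. by move=> Bb; rewrite !evE_rho Bb ev_lact. Qed.

(** Evaluating [x E(y a)] on [v] is evaluating [x E(y)] on [v a], and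
    [x E(y) = x y_0 φ(y_1)] factors through [can]. *)
Lemma tliftB_ev v a :
  tliftB (fun x y => x * E (y * a)) v = ev phi (canr (tensB_ract v a)).
Proof.
have bE : bilinear_for *:%R *:%R (fun x y => x * E (y * a)) :=
  mul_bilinear (@linear_id k A) (linear_comp (linearP E) (mull_linear a)).
have balE : balanced B (fun x y => x * E (y * a)).
  apply: (mul_balancedr (f := fun y => E (y * a))) => b y Bb.
  by rewrite -mulrA; apply: expectation_Bl.
have R := tensB_ract_linear (rho := rho) a.
have K := can_linear (rho := rho).
apply: (linear_tensB_ext (tliftB_linear bE balE)
  (linear_comp ev_linear (linear_comp K R))) => x y /=.
by rewrite (tliftBE bE balE) tensB_ractE ev_can evE_rho.
Qed.

(** By [rho_ev_rho] and [coinv1P], [E(a)] is coinvariant if and only if the two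
    sides of (i), extended left [A]-linearly to [A ⊗ C], agree at [ρ(a)].  If
    this holds for all [a], they agree on all of [A ⊗ C] by [can_ext], hence on
    every [1 ⊗ c]. *)
Lemma expectation_coinvP : right_comodule rho ->
  (forall a, B (E a)) <->
  (forall c, entw_coprod c = lact (phi c) (rho 1)).
Proof.
move=> rhoP.
have L1 : linear (fun c => lact (phi c) (rho 1)).
  by move=> l u v; rewrite linearP lactDZ.
have b1 := lact_linear_bilinear (@linear_id k A) L1.
have lift1 z : tlift (fun x c => lact x (lact (phi c) (rho 1))) z =
    lact (ev phi z) (rho 1).
  have Lev : linear (fun z => lact (ev phi z) (rho 1)).
    by move=> l u v; rewrite ev_linear lactDZ.
  apply: (linear_tens_ext (tlift_linear b1) Lev) => x c.
  by rewrite (tliftE b1) evE lactM.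
split=> [BE c|phiB a]; last first.
  have entw_coprodE : entw_coprod = fun c => lact (phi c) (rho 1) by apply: funext.
  apply/(coinv1P (E a)); rewrite (evE_rho a) (rho_ev_rho a rhoP) entw_coprodE.
  exact: (lift1 (rho a)).
suff e : tlift (fun x c => lact x (entw_coprod c)) =1
    tlift (fun x c => lact x (lact (phi c) (rho 1))).
  have := e (1 ⊗ c).
  by rewrite (tliftE entw_coprod_bilinear) (tliftE b1) !lact1.
have lact_tlift (h : C -> (A ⊗ C)%type) : linear h -> forall x z,
    tlift (fun y d => lact y (h d)) (lact x z) =
    lact x (tlift (fun y d => lact y (h d)) z).
  move=> lh x; have bh := lact_linear_bilinear (@linear_id k A) lh.
  have Lh := tlift_linear bh; have Lx := lact_linear (C := C) x.
  apply: (linear_tens_ext (linear_comp Lh Lx) (linear_comp Lx Lh)) => y d /=.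
  by rewrite lactE !(tliftE bh) lactM.
apply: (can_ext (tlift_linear entw_coprod_bilinear) (tlift_linear b1)) => x y.
rewrite (lact_tlift _ entw_coprod_linear) (lact_tlift _ L1).
by rewrite -(rho_ev_rho y rhoP) lift1 -evE_rho; congr lact; apply/coinv1P.
Qed.

(** Both sides are equalities between [ev phi (z b)] and [ev phi z * b], on the
    elements [z = ρ(a)] and [z = 1 ⊗ c] respectively; each of these families
    generates [A ⊗ C] as a left [A]-module. *)
Lemma expectation_BrP :
  (forall a b, B b -> E (a * b) = E a * b) <->
  (forall b c, B b -> ev phi (entw rho (c ⊗ b)) = phi c * b).
Proof.
have ev_ract b x c : ev phi (entw_ract (x ⊗ c) b) = x * ev phi (entw rho (c ⊗ b)).
  by rewrite entw_ractE ev_lact.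
have Lr b := linear_comp (mull_linear b) ev_linear.
split=> [EB b c Bb|phiB a b Bb]; last first.
  rewrite !evE_rho rhoM.
  apply: (linear_tens_ext (linear_comp ev_linear (entw_ract_linear b)) (Lr b)).
  by move=> x c /=; rewrite ev_ract phiB // evE mulrA.
have := ev_ract b 1 c; rewrite mul1r => <-; rewrite -[phi c]mul1r -evE.
move: (1 ⊗ c).
apply: (can_ext (linear_comp ev_linear (entw_ract_linear b)) (Lr b)) => x y /=.
by rewrite entw_ract_lact -rhoM !ev_lact -!evE_rho EB // mulrA.
Qed.

Lemma conditional_expectationP : right_comodule rho ->
  conditional_expectation B E <->
  [/\ forall c, entw_coprod c = lact (phi c) (rho 1),
      ev phi (rho 1) = 1 &
      forall b c, B b -> ev phi (entw rho (c ⊗ b)) = phi c * b].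
Proof.
move=> rhoP; rewrite -evE_rho; split.
  case=> /(expectation_coinvP rhoP) c1 E1 _ /expectation_BrP c3.
  by split.
case=> /(expectation_coinvP rhoP) BE E1 /expectation_BrP Er.
split; [exact: BE | exact: E1 | | exact: Er].
by move=> b a; apply: expectation_Bl.
Qed.

End Evaluation.

(** The map is [φ(c) = c' E(c'')] for [can^-1(1 ⊗ c)] equal to [c' ⊗ c''];
    left [B]-linearity of [E] makes [x ⊗ y |-> x E(y)] well defined on
    [A ⊗_B A]. *)
Lemma expectation_map (E : {linear A -> A}) : conditional_expectation B E ->
  exists phi : {linear C -> A}, forall a, E a = ev phi (rho a).
Proof.
move=> [_ _ EBl _].
have bE : bilinear_for *:%R *:%R (fun x y : A => x * E y) :=
  mul_bilinear (@linear_id k A) (linearP E).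
have balE : balanced B (fun x y => x * E y) := mul_balancedr EBl.
have FE := tliftBE bE balE.
set F := tliftB _ in FE.
have FL : linear F := tliftB_linear bE balE.
pose f (c : C) := F (can_inv rho (1 ⊗ c)).
have fL : linear f.
  have [_ tr] := tmul_bilinear A C.
  by move=> l u v; rewrite /f tr can_inv_linear FL.
have [phi phiE] : exists phi : {linear C -> A}, phi =1 f.
  by exists (HB.pack_for {linear C -> A} f
    (GRing.isLinear.Build k C A *:%R f fL)).
exists phi => a.
rewrite -[E a]mul1r -(FE 1 a) -can_inv_rho.
apply: (linear_tens_ext (linear_comp FL can_inv_linear) (ev_linear phi)).
move=> x c /=; rewrite can_inv_tmul evE phiE /f.
move: (can_inv _ _) => u.
apply: (linear_tensB_ext (linear_comp FL (tensB_lact_linear x))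
  (linear_comp (mulr_linear x) FL)) => y z /=.
by rewrite tensB_lactE !FE mulrA.
Qed.

(** [E(a u_i) u^i = E(u_i) u^i a] for a central [u], because [x ⊗ y |-> E(x) y]
    is well defined on [A ⊗_B A]: the first equation of strong separability
    thus reduces to its instance at [a = 1]. *)
Lemma tliftB_expectation_central (E : {linear A -> A}) u a :
  (forall x b, B b -> E (x * b) = E x * b) ->
  tensB_lact a u = tensB_ract (B := B) u a ->
  tliftB (fun x y => E (a * x) * y) u = tliftB (fun x y => E x * y) u * a.
Proof.
move=> EB uC.
have bE : bilinear_for *:%R *:%R (fun x y => E (a * x) * y) :=
  mul_bilinear (linear_comp (linearP E) (mulr_linear a)) (@linear_id k A).
have balE : balanced B (fun x y => E (a * x) * y).
  apply: (mul_balancedl (f := fun x => E (a * x))) => x b Bb.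
  by rewrite mulrA; apply: EB.
have b1 : bilinear_for *:%R *:%R (fun x y => E x * y) :=
  mul_bilinear (linearP E) (@linear_id k A).
have bal1 : balanced B (fun x y => E x * y) := mul_balancedl EB.
have G := tliftB_linear b1 bal1.
transitivity (tliftB (fun x y => E x * y) (tensB_lact a u)).
  apply: (linear_tensB_ext (tliftB_linear bE balE)
    (linear_comp G (tensB_lact_linear a))) => x y /=.
  by rewrite (tliftBE bE balE) tensB_lactE (tliftBE b1 bal1).
rewrite uC.
apply: (linear_tensB_ext (linear_comp G (tensB_ract_linear (rho := rho) a))
  (linear_comp (mull_linear a) G)) => x y /=.
by rewrite tensB_ractE !(tliftBE b1 bal1) mulrA.
Qed.

End Entwining.

(** * Strong separability *)

Theorem proposition6p3 (k : fieldType) (C : coalgType k) (A : falgType k)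
    (rho : {linear A -> (A ⊗ C)%type}) (rhoP : right_comodule rho)
    (canP : coalgebra_galois rho) (freeP : right_free (coinv rho)) :
  strongly_separable (coinv rho) <->
  exists (z : (A ⊗ C)%type) (phi : {linear C -> A}) (tau : k),
    [/\ integral rho z /\ normalised z,
        forall c : C, entw rho (tmap (@id C) phi (coprod c)) = lact (phi c) (rho 1),
        tlift (fun (a : A) (d : C) => a * phi d) (rho 1) = 1,
        forall (b : A) (c : C), coinv rho b ->
          tlift (fun (a : A) (d : C) => a * phi d) (entw rho (c ⊗ b)) = phi c * b &
        tau != 0 /\ tlift (fun (a : A) (c : C) => a * phi c) z = tau%:A].
Proof.
split.
  case=> _ _ [u [E [tau [[uC u1] EP tau_unit _ uE]]]].
  have [phi phiE] := expectation_map canP EP.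
  have [c1 c2 c3] := (conditional_expectationP canP phiE rhoP).1 EP.
  exists (can u), phi, tau; split; [ | exact: c1 | exact: c2 | exact: c3 | ].
    by split; [apply/(integral_can canP) | apply/(normalised_can u rhoP)].
  split; first by rewrite -unitfE.
  (* The right action of 1 is traded for the left one, as u is central. *)
  have := uE 1; rewrite (tliftB_ev phiE u 1) -(uC 1) (can_lact 1 u) lact1 mul1r.
  exact.
case=> z [phi [tau [[zI zN] c1 c2 c3 [tau0 ztau]]]].
have [K K'] := can_invK canP.
pose u := can_inv rho z.
have uz : can u = z := K' z.
have uC : forall a, tensB_lact a u = tensB_ract u a.
  by apply/(integral_can canP); rewrite uz.
have uI : separability_idempotent u.
  by split=> //; apply/(normalised_can u rhoP); rewrite uz.
have evL := linear_comp (ev_linear phi) (linearP rho).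
have [E phiE] : exists E : {linear A -> A}, forall a, E a = ev phi (rho a).
  by exists (HB.pack_for {linear A -> A} (ev phi \o rho)
    (GRing.isLinear.Build k A A *:%R _ evL)).
have EP : conditional_expectation (coinv rho) E.
  by apply/(conditional_expectationP canP phiE rhoP).
have [_ _ EBl EBr] := EP.
have uEr a : tliftB (fun x y => x * E (y * a)) u = a * tau%:A.
  by rewrite (tliftB_ev phiE u a) -(uC a) (can_lact a u) ev_lact uz; congr (_ * _).
split; [by exists u | by exists E | exists u, E, tau; split=> //].
  by rewrite unitfE.
move=> a; rewrite (tliftB_expectation_central EBr (uC a)).
suff -> : tliftB (fun x y => E x * y) u = tau%:A.
  by rewrite mulr_algl mulr_algr.
have [t ut] := tensB_gen u.
have [B1 Blin BM] := coinv_subalg rho.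
have b1 : bilinear_for *:%R *:%R (fun x y => E x * y) :=
  mul_bilinear (linearP E) (@linear_id k A).
have bE a' : bilinear_for *:%R *:%R (fun x y => x * E (y * a')) :=
  mul_bilinear (@linear_id k A) (linear_comp (linearP E) (mull_linear a')).
have balE a' : balanced (coinv rho) (fun x y => x * E (y * a')).
  apply: (mul_balancedr (f := fun y => E (y * a'))) => b y Bb.
  by rewrite -mulrA; apply: EBl.
rewrite ut (tliftB_sum b1 (mul_balancedl EBr)).
apply: (dual_basis_sym B1 Blin BM tau0 EP _ freeP) => a'.
by rewrite -(tliftB_sum (bE a') (balE a')) -ut uEr mulr_algr.
Qed.
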